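(* Let $R,S$ be two Dedekind domains with torsion class group, let $h:G(R)\longrightarrow G(S)$ be a homeomorphism, and let $P$ be a nonzero prime ideal of $R$. Then the map $$\overline{h}\colon\mathcal{X}(P)\longrightarrow\mathcal{X}(h(P)),\qquad X\longmapsto h(X)$$ is an order isomorphism, when $\mathcal{X}(P)$ and $\mathcal{X}(h(P))$ are endowed with the containment order.
   Context: A Dedekind domain is a one-dimensional Noetherian integrally closed domain; $U(R)$ is the group of units of $R$; $R^\bullet:=R\setminus\{0\}$. The Golomb space $G(R)$ is the set $R^\bullet$ endowed with the topology generated by the cosets $a+I$, where $a\in R$ and $I$ is a nonzero ideal of $R$ such that $\langle a,I\rangle=R$. Here $h(P)$ means $h(P\setminus\{0\})\cup\{0\}$; for $R,S$ with torsion class group it is a nonzero prime ideal of $S$. The $P$-topology on $R\setminus P$ is the topology generated by the subsets of $R\setminus P$ that are clopen in $R\setminus P$ with respect to the Golomb topology; it coincides with the restriction of the $P$-adic topology, i.e., it is generated by the cosets $a+P^n$ with $a\in R\setminus P$, $n\geq 1$. For $a\in R\setminus P$, $\mathrm{pow}(a):=\{ua^t\mid u\in U(R),\ t\in\mathbb{N},\ t\geq 1\}$. An almost prime element of $R$ is an irreducible element generating a primary ideal. $\mathcal{X}(P)$ is the set of the closures, in the $P$-topology, of $\mathrm{pow}(q)$, as $q$ ranges among the almost prime elements of $R$ outside $P$; $\mathcal{X}(h(P))$ is defined in the same way for $S$ and $h(P)$. *)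

(* Defs.v *)
From HB Require Import structures.
From mathcomp Require Import all_boot all_order all_algebra.
From mathcomp Require Import boolp classical_sets functions topology.

Set Implicit Arguments.
Unset Strict Implicit.
Unset Printing Implicit Defensive.

Import GRing.Theory.
Local Open Scope classical_set_scope.
Local Open Scope ring_scope.

(* The ideals of ring_quotient.v are boolean predicates and are required to   *)
(* be proper; here an ideal is an arbitrary classical set, and the unit ideal *)
(* is allowed.                                                                *)
Definition ideal (R : comNzRingType) (I : set R) : Prop :=
  [/\ I 0, forall x y, I x -> I y -> I (x + y) & forall a x, I x -> I (a * x)].

Definition ideal_span (R : comNzRingType) (A : set R) : set R :=
  smallest (@ideal R) A.

Definition prime_ideal (R : comNzRingType) (P : set R) : Prop :=
  [/\ ideal P, P != setT & forall x y, P (x * y) -> P x \/ P y].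

Definition primary_ideal (R : comNzRingType) (Q : set R) : Prop :=
  [/\ ideal Q, Q != setT &
      forall x y, Q (x * y) -> Q x \/ exists2 n, (0 < n)%N & Q (y ^+ n)].

Definition noetherian (R : comNzRingType) : Prop :=
  forall I : set R, ideal I -> exists s : seq R, I = ideal_span [set` s].

(* A chain of length n has n + 1 members. *)
Definition has_prime_chain (R : comNzRingType) (n : nat) : Prop :=
  exists p : nat -> set R,
    (forall i, (i <= n)%N -> prime_ideal (p i)) /\
    (forall i, (i < n)%N -> p i `<` p i.+1).

Definition has_krull_dim (R : comNzRingType) (n : nat) : Prop :=
  has_prime_chain R n /\ ~ has_prime_chain R n.+1.

Definition integrally_closed (R : idomainType) : Prop :=
  forall z : {fraction R},
    integralOver (@tofrac R) z -> exists r : R, z = tofrac r.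

Definition dedekind_domain (R : idomainType) : Prop :=
  [/\ has_krull_dim R 1, noetherian R & integrally_closed R].

Section ClassGroup.
Variable R : idomainType.
Local Notation K := {fraction R}.

Definition submodule_frac (M : set K) : Prop :=
  [/\ M 0, forall x y, M x -> M y -> M (x + y) &
      forall (r : R) x, M x -> M (tofrac r * x)].

Definition fractional_ideal (M : set K) : Prop :=
  [/\ submodule_frac M, exists2 x, M x & x != 0 &
      exists2 d : R, d != 0 &
        forall x, M x -> exists r : R, tofrac d * x = tofrac r].

Definition frac_mul (M N : set K) : set K :=
  smallest submodule_frac [set z | exists x y, [/\ M x, N y & z = x * y]].

Definition frac_one : set K := range (@tofrac R).

Definition frac_exp (M : set K) (n : nat) : set K :=
  iter n (frac_mul M) frac_one.

(* M and N represent the same element of the class group. *)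
Definition same_class (M N : set K) : Prop :=
  exists2 x : K, x != 0 & M = ( *%R x) @` N.

(* In a Dedekind domain every nonzero fractional ideal is invertible, so the  *)
(* class group is the set of all of them modulo same_class.                   *)
Definition torsion_class_group : Prop :=
  forall M, fractional_ideal M ->
    exists2 n, (0 < n)%N & same_class (frac_exp M n) frac_one.

End ClassGroup.

Definition irreducible_elt (R : idomainType) (q : R) : Prop :=
  [/\ q != 0, q \isn't a GRing.unit &
      forall a b, q = a * b -> a \is a GRing.unit \/ b \is a GRing.unit].

Definition almost_prime (R : idomainType) (q : R) : Prop :=
  irreducible_elt q /\ primary_ideal (ideal_span [set q]).

Definition golomb (R : idomainType) : Type := {x : R | x != 0}.

HB.instance Definition _ (R : idomainType) :=
  SubChoice.copy (golomb R) {x : R | x != 0}.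

Definition golomb_coset (R : idomainType) (a : R) (I : set R) :
  set (golomb R) := [set x | exists2 i, I i & \val x = a + i].

Definition golomb_cosets (R : idomainType) : set (set (golomb R)) :=
  [set U | exists (a : R) (I : set R),
     [/\ ideal I, exists2 i, I i & i != 0,
         ideal_span (a |` I) = setT & U = golomb_coset a I]].

HB.instance Definition _ (R : idomainType) :=
  isSubBaseTopological.Build (golomb R) (@golomb_cosets R) id.

Definition homeomorphism (X Y : topologicalType) (h : X -> Y) : Prop :=
  continuous h /\ exists g, [/\ cancel h g, cancel g h & continuous g].

(* h(P), i.e. h(P \ {0}) together with 0. *)
Definition golomb_image (R S : idomainType) (h : golomb R -> golomb S)
  (P : set R) : set S := 0 |` [set \val (h x) | x in [set x | P (\val x)]].

(* As a subset of the Golomb space; meant for sets P containing 0. *)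
Definition golomb_off (R : idomainType) (P : set R) : set (golomb R) :=
  [set x | ~ P (\val x)].

(* The set R \ P with the P-topology, whereas golomb_off P seen as a type     *)
(* carries the topology induced by the Golomb space.                          *)
Definition ptop (R : idomainType) (P : set R) : Type := golomb_off P.

HB.instance Definition _ (R : idomainType) (P : set R) :=
  SubChoice.copy (ptop P) (golomb_off P).

HB.instance Definition _ (R : idomainType) (P : set R) :=
  isSubBaseTopological.Build (ptop P)
    [set U : set (golomb_off P) | clopen U] id.

Definition pow_set (R : idomainType) (P : set R) (a : R) : set (ptop P) :=
  [set x | exists u t, [/\ u \is a GRing.unit, (0 < t)%N &
                           \val (\val x) = u * a ^+ t]].

(* The closures are taken in R \ P with the P-topology, and then regarded as  *)
(* subsets of the Golomb space.                                               *)
Definition pow_closures (R : idomainType) (P : set R) :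
  set (set (golomb R)) :=
  [set X | exists q : R, [/\ almost_prime q, ~ P q &
                             X = \val @` closure (@pow_set R P q)]].

Definition containment_isomorphism (T U : Type)
  (X : set (set T)) (Y : set (set U)) (f : set T -> set U) : Prop :=
  set_bij X Y f /\
  forall A B, X A -> X B -> (A `<=` B <-> f A `<=` f B).

(* Main.v *)
Require Import Defs.
From mathcomp Require Import all_boot all_order all_algebra.
From mathcomp Require Import boolp classical_sets functions topology.
From mathcomp Require Import ring.
Set Implicit Arguments.
Unset Strict Implicit.
Unset Printing Implicit Defensive.
Import GRing.Theory.
Local Open Scope classical_set_scope.
Local Open Scope ring_scope.

(** Write V(x) for the set of primes containing x. The whole argument rests on
one fact: the relation V(y) <= V(x) between nonzero elements can be read off
from the Golomb topology, so a homeomorphism preserves it.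

To see this, let z, x, w be distinct points and ask whether each neighbourhood
U of z admits neighbourhoods A of x and B of w with
cl A /\ cl B <= cl U. The closure of a coset x + I, with I a product of powers
P_i ^ e_i, is the intersection of the sets P_i \/ (x + P_i ^ e_i). When
neither x nor w lies in P_i, small cosets around x and w are disjoint modulo
a power of P_i, and only P_i remains of the intersection of their closures.
Hence the condition holds exactly when V(x) and V(w) are contained in V(z)
([supp_le_closures_refine], [closures_refine_supp_le]). Quantifying over z and
w gives V(y) <= V(x) ([refines_leP]).

Since the class group is torsion, each nonzero prime P is the only prime
containing some a, so these a are the elements whose support is minimal
nonempty ([supported_atP]), and the nonzero elements of P are the y with
V(a) <= V(y). Hence h maps nonzero primes to nonzero primes
([golomb_image_prime]).

If q is almost prime, V(q) is a single prime Q. Elements supported at Q are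
totally ordered by divisibility ([dvd_total]), so the irreducible q divides
all of them, and pow(q) is the set of all x with V(x) = {Q} ([pow_setE]). Thus
h maps pow(q) onto pow(q') for any almost prime q' having the same
support as h(q). The P-topology is defined by clopen sets of the Golomb
space R \ P, so h is also a homeomorphism for it and maps closures to closures
([image_pow_closures]). The same applies to the inverse of h, and taking
images under a bijection preserves and reflects containment.

Closures are computed with elements rather than with factorizations of
ideals: what replaces the comparison of exponents is that, for j nonzero and
any f, some f ^+ m * (1 - f * s) is a multiple of j ([pi_regular]). At a prime
containing f the second factor is invertible, so f ^+ m absorbs there the
whole contribution of j. *)

(** * Ideals and primes of a commutative ring *)

Definition principal (R : comNzRingType) (d : R) : set R :=
  [set x | exists r, x = d * r].

Definition coprime_elts (R : comNzRingType) (a b : R) : Prop :=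
  exists r s, a * r + b * s = 1.

(** The containment V(x) <= V(y). *)
Definition supp_le (R : comNzRingType) (x y : R) : Prop :=
  forall Q : set R, prime_ideal Q -> Q x -> Q y.

(** The support V(a) is the single prime P. *)
Definition supported_at (R : comNzRingType) (P : set R) (a : R) : Prop :=
  P a /\ forall Q : set R, prime_ideal Q -> Q a -> Q = P.

Section CommutativeRings.
Variable R : comNzRingType.
Implicit Types (I J P Q S : set R) (a b d x y : R).

Lemma idealM I a x : ideal I -> I x -> I (x * a).
Proof. by case=> _ _ IM Ix; rewrite mulrC; exact: IM. Qed.

Lemma idealB I x y : ideal I -> I x -> I y -> I (x - y).
Proof.
by case=> _ ID IM Ix Iy; apply: ID => //; rewrite -mulN1r; exact: IM.
Qed.

Lemma ideal_principal d : ideal (principal d).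
Proof.
split; first by exists 0; rewrite mulr0.
- by move=> _ _ [r ->] [s ->]; exists (r + s); rewrite mulrDr.
- by move=> a _ [r ->]; exists (a * r); rewrite mulrCA.
Qed.

Lemma ideal_span1 d : ideal_span [set d] = principal d.
Proof.
apply/seteqP; split=> x.
  apply; split; first exact: ideal_principal.
  by move=> _ ->; exists 1; rewrite mulr1.
by move=> [r ->] M [idM dM]; apply: idealM => //; exact: dM.
Qed.

Definition adjoin I x : set R :=
  [set z | exists2 i, I i & exists r, z = i + x * r].

Lemma ideal_adjoin I x : ideal I -> ideal (adjoin I x).
Proof.
move=> idI; have [I0 ID IM] := idI; split.
- by exists 0 => //; exists 0; rewrite mulr0 addr0.
- move=> _ _ [i Ii [r ->]] [j Ij [s ->]]; exists (i + j); first exact: ID.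
  by exists (r + s); ring.
- move=> a _ [i Ii [r ->]]; exists (a * i); first exact: IM.
  by exists (a * r); ring.
Qed.

Lemma adjoin_sub I x : I `<=` adjoin I x.
Proof. by move=> i Ii; exists i => //; exists 0; rewrite mulr0 addr0. Qed.

Lemma adjoin_mem I x : ideal I -> adjoin I x x.
Proof. by case=> I0 _ _; exists 0 => //; exists 1; rewrite mulr1 add0r. Qed.

Lemma span_eqT a I : ideal I ->
  ideal_span (a |` I) = setT <-> exists2 i, I i & exists r, i + a * r = 1.
Proof.
move=> idI; split=> [spanT|[i Ii [r e]]].
  have : ideal_span (a |` I) 1 by rewrite spanT.
  have sub : a |` I `<=` adjoin I a.
    by move=> x [->|/adjoin_sub//]; exact: adjoin_mem.
  move=> /(_ _ (conj (ideal_adjoin a idI) sub)) [i Ii [r e]].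
  by exists i => //; exists r.
apply/seteqP; split=> // x _ M [idM aIM].
rewrite -[x]mul1r -e; apply: idealM => //; have [_ MD _] := idM.
by apply: MD; [apply: aIM; right|apply: idealM => //; apply: aIM; left].
Qed.

Lemma prime_not1 P : prime_ideal P -> ~ P 1.
Proof.
move=> [idP /eqP PT _] P1; apply: PT; apply/seteqP; split=> // x _.
by rewrite -[x]mul1r; exact: idealM.
Qed.

Lemma prime_mulN P x y : prime_ideal P -> ~ P x -> ~ P y -> ~ P (x * y).
Proof. by move=> [_ _ pP] Px Py /pP[]. Qed.

Lemma prime_expN P x n : prime_ideal P -> ~ P x -> ~ P (x ^+ n).
Proof.
move=> pP Px; elim: n => [|n IHn]; first by rewrite expr0; exact: prime_not1.
by rewrite exprS; exact: prime_mulN.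
Qed.

Lemma prime_exp P x n : prime_ideal P -> P (x ^+ n) -> P x.
Proof.
by move=> pP Pxn; apply: contrapT => nPx; exact: prime_expN pP nPx Pxn.
Qed.

Lemma prime_addN P x y : prime_ideal P -> ~ P x -> P y -> ~ P (x + y).
Proof.
move=> [idP _ _] Px Py Pxy; apply: Px.
by rewrite -[x](addrK y); exact: idealB.
Qed.

Lemma prime_one_sub P f s : prime_ideal P -> P f -> ~ P (1 - f * s).
Proof.
move=> pP Pf; have [idP _ _] := pP.
have -> : 1 - f * s = 1 + f * (- s) by ring.
by apply: prime_addN => //; [exact: prime_not1|exact: idealM].
Qed.

(** Zorn's lemma gives an ideal maximal among those that contain I and miss S.
If x and y lie outside it, adjoining either one produces an element of S, and
the product of these two elements would lie in the ideal if x * y did. *)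
Lemma prime_avoiding I S : ideal I -> S 1 ->
    (forall x y, S x -> S y -> S (x * y)) -> (forall x, I x -> ~ S x) ->
  exists P, [/\ prime_ideal P, I `<=` P & forall x, P x -> ~ S x].
Proof.
move=> idI S1 SM IS.
pose good A := [/\ ideal A, I `<=` A & forall x, A x -> ~ S x].
(* The empty set is admitted because it is the union of the empty chain. *)
have [F FP totF|A [goodA maxA]] := @Zorn_bigcup R [set A | A = set0 \/ good A].
  have [[A0 FA0 gA0]|noF] := pselect (exists2 A, F A & good A); last first.
    left; apply/seteqP; split=> // x [A FA Ax].
    by have [A0|gA] := FP _ FA; [rewrite A0 in Ax|case: noF; exists A].
  have gF A x : F A -> A x -> good A.
    by move=> FA Ax; have [A_0|//] := FP _ FA; rewrite A_0 in Ax.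
  right; split.
  - split.
    + by exists A0 => //; have [[]] := gA0.
    + move=> x y [A FA Ax] [B FB By].
      have [[[_ AD _] _ _] [[_ BD _] _ _]] := (gF _ _ FA Ax, gF _ _ FB By).
      have [AB|BA] := totF _ _ FA FB.
        by exists B => //; apply: BD => //; exact: AB.
      by exists A => //; apply: AD => //; exact: BA.
    + move=> a x [A FA Ax]; exists A => //.
      by have [[_ _ AM] _ _] := gF _ _ FA Ax; exact: AM.
  - by move=> x Ix; exists A0 => //; have [_ + _] := gA0; exact.
  - by move=> x [A FA Ax]; have [_ _ +] := gF _ _ FA Ax; exact.
have gI : good I by split.
have {goodA}gA : good A.
  case: goodA => // A0; exfalso; apply: (maxA I); last by right.
  split; first by rewrite A0.
  by rewrite A0 => /(_ 0); apply; case: idI.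
have [idA IA AS] := gA.
have meetS x : ~ A x -> exists2 z, adjoin A x z & S z.
  move=> nAx; apply: contrapT => noz; apply: (maxA (adjoin A x)).
    split; first exact: adjoin_sub.
    by move=> /(_ _ (adjoin_mem x idA)).
  right; split; first exact: ideal_adjoin.
    by move=> y /IA; exact: adjoin_sub.
  by move=> z Az Sz; apply: noz; exists z.
exists A; split=> //; split=> //.
  by apply/eqP => AT; apply: (AS 1) => //; rewrite AT.
move=> x y Axy; apply: contrapT => /not_orP[/meetS[_ [a Aa [r ->]] Sx]].
move=> /meetS[_ [b Ab [s ->]] Sy].
apply: (AS _ _ (SM _ _ Sx Sy)).
have -> : (a + x * r) * (b + y * s) =
    a * (b + y * s) + (b * (x * r) + x * y * (r * s)) by ring.
have [_ AD _] := idA.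
by apply: (AD); [exact: idealM|apply: (AD); exact: idealM].
Qed.

Lemma prime_over_proper I : ideal I -> ~ I 1 ->
  exists2 P, prime_ideal P & I `<=` P.
Proof.
move=> idI I1; have [||x Ix e|P [pP IP _]] := @prime_avoiding I [set 1] idI.
- by [].
- by move=> _ _ -> ->; rewrite /= mulr1.
- by apply: I1; rewrite -e.
by exists P.
Qed.

Lemma coprime_eltsP a b :
  (forall P, prime_ideal P -> P a -> ~ P b) -> coprime_elts a b.
Proof.
move=> ab; have idab := ideal_adjoin b (ideal_principal a).
have [[_ [r ->] [s e]]|no1] := pselect (adjoin (principal a) b 1).
  by exists r, s.
have [P pP subP] := prime_over_proper idab no1.
exfalso; apply: (ab P pP); apply: subP; last first.
  by apply: adjoin_mem; exact: ideal_principal.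
by apply: adjoin_sub; exists 1; rewrite mulr1.
Qed.

Lemma coprime_prime P a b : prime_ideal P -> coprime_elts a b -> P a -> ~ P b.
Proof.
move=> pP [r [s e]] Pa Pb; apply: (prime_not1 pP); rewrite -e.
by have [idP _ _] := pP; have [_ PD _] := idP; apply: PD; exact: idealM.
Qed.

Lemma coprime_eltsMr a b c : coprime_elts a b -> coprime_elts a c ->
  coprime_elts a (b * c).
Proof.
move=> ab ac; apply: coprime_eltsP => P pP Pa.
by apply: prime_mulN => //; [exact: coprime_prime Pa|exact: coprime_prime Pa].
Qed.

Lemma coprime_eltsX a b n : coprime_elts a b -> coprime_elts a (b ^+ n).
Proof.
move=> ab; apply: coprime_eltsP => P pP Pa; apply: prime_expN => //.
exact: coprime_prime Pa.
Qed.

End CommutativeRings.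

(** * One-dimensional domains *)

Section DimensionOne.
Variable R : idomainType.
Hypothesis dedR : dedekind_domain R.
Implicit Types (P Q : set R) (a b d f j x y : R).

Lemma prime0 : prime_ideal [set (0 : R)].
Proof.
split.
- by split=> // [_ _ -> ->|a _ ->]; rewrite /= ?addr0 ?mulr0.
- apply/eqP => /seteqP[_ /(_ 1 I)] /= /eqP.
  by rewrite oner_eq0.
- by move=> x y /= /eqP; rewrite mulf_eq0 => /orP[] /eqP; [left|right].
Qed.

Lemma prime_max P Q x : prime_ideal P -> prime_ideal Q -> x != 0 -> P x ->
  P `<=` Q -> P = Q.
Proof.
move=> pP pQ x0 Px PQ; apply: contrapT => neq.
have [[_ nochain] _ _] := dedR; apply: nochain.
exists (fun i =>
  if i is i'.+1 then if i' is 0 then P else Q else [set 0]); split.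
  by case=> [|[|i]] // _; exact: prime0.
case=> [|[|i]] // _.
  split=> [_ ->|/(_ _ Px)/= xe]; first by have [[]] := pP.
  by rewrite xe eqxx in x0.
by split=> // QP; apply: neq; apply/seteqP.
Qed.

Lemma prime_comax P x y : prime_ideal P -> y != 0 -> P y -> ~ P x ->
  exists2 p, P p & exists s, p + x * s = 1.
Proof.
move=> pP y0 Py nPx; have [idP _ _] := pP; apply: contrapT => no.
have [|Q pQ subQ] := @prime_over_proper _ (adjoin P x) (ideal_adjoin x idP).
  by move=> [p Pp [s e]]; apply: no; exists p => //; exists s.
have PQ : P = Q.
  apply: (prime_max pP pQ y0 Py) => z Pz; apply: subQ; exact: adjoin_sub.
by apply: nPx; rewrite PQ; apply: subQ; exact: adjoin_mem.
Qed.

(** The quotient of a one-dimensional domain by a nonzero element has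
dimension zero, so the ideals generated by the powers of [f] become stationary
there. The set of the [f ^+ m * (1 - f * s)] is multiplicative; a prime over
[j] missing it would be maximal, [f] would be invertible modulo it, and it
would contain some [1 - f * s]. *)
Lemma pi_regular j f : j != 0 ->
  exists m s k, f ^+ m * (1 - f * s) = j * k.
Proof.
move=> j0; pose S := [set z | exists m s, z = f ^+ m * (1 - f * s)].
apply: contrapT => no.
have [||x [k ->] [m [s e]]|P [pP jP PS]] :=
    @prime_avoiding _ (principal j) S (ideal_principal j).
- by exists 0%N, 0; ring.
- move=> _ _ [m [s ->]] [n [t ->]]; exists (m + n)%N, (s + t - f * s * t).
  by rewrite exprD; ring.
- by apply: no; exists m, s, k.
have Pj : P j by apply: jP; exists 1; rewrite mulr1.
have Pf : ~ P f by move=> /PS; apply; exists 1%N, 0; ring.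
have [p Pp [s e]] := prime_comax pP j0 Pj Pf.
by apply: (PS p Pp); exists 0%N, s; rewrite -e; ring.
Qed.

(** If [e] divides [a ^+ m * (1 - a * s)] and [a ^+ m.+1] divides [e], then [a]
divides [1 - a * s], hence [1]. *)
Lemma expr_not_dvd a e : a != 0 -> a \isn't a GRing.unit -> e != 0 ->
  exists N, ~ principal (a ^+ N) e.
Proof.
move=> a0 au e0; have [m [s [k E]]] := pi_regular a e0.
exists m.+1 => -[r er]; move/negP: au; apply.
have : a ^+ m * (1 - a * s) = a ^+ m * (a * (r * k)).
  by rewrite E er exprS; ring.
move=> /(mulfI (expf_neq0 _ a0)) E1; apply/unitrPr; exists (s + r * k).
by rewrite mulrDr -E1; ring.
Qed.

End DimensionOne.

(** * Consequences of a torsion class group *)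

Section Torsion.
Variable R : idomainType.
Hypotheses (dedR : dedekind_domain R) (torR : torsion_class_group R).
Local Notation K := {fraction R}.
Implicit Types (I P Q : set R) (a b d q x y : R).

Lemma frac_exp_sub I n : ideal I ->
  frac_exp (@tofrac R @` I) n.+1 `<=` @tofrac R @` I.
Proof.
move=> idI; have [I0 ID IM] := idI; elim: n => [|n IHn].
all: apply: smallest_sub.
1,3: split.
1,4: by exists 0; rewrite ?tofrac0.
1,3: by move=> _ _ [x Ix <-] [y Iy <-]; exists (x + y);
  [exact: ID|exact: tofracD].
1,2: by move=> r _ [x Ix <-]; exists (r * x); [exact: IM|exact: tofracM].
  move=> _ [_ [_ [[x Ix <-] [r _ <-] ->]]].
  by exists (x * r); [exact: idealM|exact: tofracM].
move=> _ [_ [w [[x Ix <-] /IHn[y Iy <-] ->]]].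
by exists (x * y); [exact: IM|exact: tofracM].
Qed.

Lemma frac_exp_mem (M : set K) n (z : K) : M z -> frac_exp M n (z ^+ n).
Proof.
move=> Mz; elim: n => [|n IHn].
  by rewrite expr0; exists 1; rewrite ?tofrac1.
by rewrite exprS => N [_ +]; apply; exists z, (z ^+ n).
Qed.

(** A power of I is generated by some c of the fraction field; c is itself in
that power, hence in I. *)
Lemma ideal_power_principal I x : ideal I -> I x -> x != 0 ->
  exists n a, [/\ (0 < n)%N, I a, a != 0 &
    frac_exp (@tofrac R @` I) n = @tofrac R @` principal a].
Proof.
move=> idI Ix x0; have [I0 ID IM] := idI.
have [|[//|n] _ [c c0 E]] := torR (M := @tofrac R @` I).
  split.
  - split; first by exists 0; rewrite ?tofrac0.
    + by move=> _ _ [y Iy <-] [z Iz <-]; exists (y + z);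
        [exact: ID|exact: tofracD].
    + by move=> r _ [y Iy <-]; exists (r * y); [exact: IM|exact: tofracM].
  - by exists (tofrac x); [exists x|rewrite tofrac_eq0].
  - exists 1; first exact: oner_neq0.
    by move=> _ [y _ <-]; exists y; rewrite tofrac1 mul1r.
have : frac_exp (@tofrac R @` I) n.+1 c.
  by rewrite E; exists 1; [exists 1; rewrite ?tofrac1|rewrite /= mulr1].
move=> /(frac_exp_sub idI)[a Ia ac]; exists n.+1, a; split=> //.
  by rewrite -tofrac_eq0 ac.
rewrite E -ac; apply/seteqP; split=> z.
  move=> [_ [r _ <-] <-]; exists (a * r); first by exists r.
  by rewrite /= tofracM.
by move=> [_ [r ->] <-]; exists (tofrac r); [exists r|rewrite /= tofracM].
Qed.

(** A generator a of a power of P does the job: a prime containing a contains a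
power of each element of P, hence P, which is maximal. *)
Lemma exists_supported_at P x : prime_ideal P -> P x -> x != 0 ->
  exists2 a, a != 0 & supported_at P a.
Proof.
move=> pP Px x0; have [idP _ _] := pP.
have [n [a [n0 Pa a0 E]]] := ideal_power_principal idP Px x0.
exists a => //; split=> // Q pQ Qa; apply/esym.
apply: (prime_max dedR pP pQ a0 Pa) => p Pp.
have : frac_exp (@tofrac R @` P) n (tofrac p ^+ n).
  by apply: frac_exp_mem; exists p.
rewrite E -tofracXn => -[_ [r ->] /eqP]; rewrite tofrac_eq => /eqP e.
apply: (prime_exp (n := n) pQ); rewrite -e; have [idQ _ _] := pQ.
exact: idealM.
Qed.

(** The quotient of x by y has its n-th power in R, so it is integral. *)
Lemma dvd_of_dvdX x y n : (0 < n)%N -> y != 0 ->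
  principal (y ^+ n) (x ^+ n) -> principal y x.
Proof.
move=> n0 y0 [t e]; have [_ _ closedR] := dedR.
have y0' : tofrac y != 0 :> K by rewrite tofrac_eq0.
have [|r er] := closedR (tofrac x / tofrac y).
  exists ('X^n - t%:P); first exact: monicXnsubC.
  rewrite rmorphB /= map_polyXn map_polyC /= /root !hornerE.
  rewrite expr_div_n -!tofracXn e tofracM mulrAC divff ?mul1r ?subrr//.
  by rewrite tofrac_eq0 expf_neq0.
exists r; apply/eqP; rewrite -tofrac_eq tofracM -er; apply/eqP.
by rewrite mulrCA divff ?mulr1.
Qed.

Lemma unit_of_no_prime x : (forall Q, prime_ideal Q -> ~ Q x) ->
  x \is a GRing.unit.
Proof.
move=> noQ; have [|r [s e]] := @coprime_eltsP _ x 0; first by move=> Q /noQ.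
by apply/unitrPr; exists r; rewrite -e mul0r addr0.
Qed.

Lemma prime_not_unit Q x : prime_ideal Q -> Q x -> x \isn't a GRing.unit.
Proof.
move=> pQ Qx; apply/negP => xu; apply: (prime_not1 pQ).
by rewrite -(divrr xu); have [idQ _ _] := pQ; exact: idealM.
Qed.

(** The n-th power of a module generated by x and y is generated by the
monomials of degree n. In the induction step, the submodule N is replaced by
the submodules of all w such that x * w, respectively y * w, lies in N. *)
Lemma frac_exp_pair_sub (M N : set K) (x y : K) n : submodule_frac N ->
  (forall z, M z -> exists r s, z = tofrac r * x + tofrac s * y) ->
  (forall i, (i <= n)%N -> N (x ^+ i * y ^+ (n - i))) ->
  frac_exp M n `<=` N.
Proof.
move=> + Mxy; elim: n N => [|n IHn] N subN Nxy.
  move=> _ [r _ <-]; have [_ _ NM] := subN.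
  rewrite -[tofrac r]mulr1; apply: NM.
  by have := Nxy 0%N isT; rewrite expr0 mulr1.
have [N0 ND NM] := subN; apply: smallest_sub => //.
have sub_colon c : submodule_frac [set w | N (c * w)].
  split=> /=; first by rewrite mulr0.
    by move=> u v Nu Nv; rewrite mulrDr; exact: ND.
  by move=> r u Nu; rewrite mulrCA; exact: NM.
have Nx : frac_exp M n `<=` [set w | N (x * w)].
  apply: IHn => // i le_in /=.
  by rewrite mulrA -exprS; have := Nxy i.+1 le_in; rewrite subSS.
have Ny : frac_exp M n `<=` [set w | N (y * w)].
  apply: IHn => // i le_in /=; rewrite mulrCA -exprS -subSn//.
  by apply: Nxy; exact: leqW.
move=> _ [_ [w [/Mxy[r [s ->]] Mw ->]]]; rewrite mulrDl -!mulrA.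
by apply: (ND); apply: (NM); [exact: Nx|exact: Ny].
Qed.

Lemma frac_exp_pair_mem (M : set K) (x y : K) n i : M x -> M y -> (i <= n)%N ->
  frac_exp M n (x ^+ i * y ^+ (n - i)).
Proof.
move=> Mx My; elim: n i => [|n IHn] [|i] // le_in.
- by exists 1; rewrite ?tofrac1 ?mulr1.
- rewrite expr0 mul1r subn0; exact: frac_exp_mem.
- move=> N [_]; apply; exists x, (x ^+ i * y ^+ (n - i)); split=> //.
    exact: IHn.
  by rewrite subSS exprS mulrA.
Qed.

(** Some power of the ideal (x, y) is generated by one [d], and [d] is a
combination of the monomials [x ^+ i * y ^+ (n - i)]. These cannot all lie in
[d Q], so one of them is [d] times an element outside [Q]. That element divides
a monomial, so no prime contains it and it is a unit. The monomial then divides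
both [x ^+ n] and [y ^+ n]; cancelling, a power of [x] divides the same power
of [y] or conversely. *)
Lemma dvd_total Q x y : prime_ideal Q -> x != 0 -> y != 0 ->
    (forall P, prime_ideal P -> P x -> P = Q) ->
    (forall P, prime_ideal P -> P y -> P = Q) ->
  principal x y \/ principal y x.
Proof.
move=> pQ x0 y0 Vx Vy; have [idQ _ _] := pQ.
pose I := adjoin (principal x) y.
have idI : ideal I by exact: ideal_adjoin (ideal_principal x).
have Ix : I x by apply: adjoin_sub; exists 1; rewrite mulr1.
have Iy : I y by apply: adjoin_mem; exact: ideal_principal.
have [n [d [n0 Id d0 E]]] := ideal_power_principal idI Ix x0.
have mon i : (i <= n)%N -> exists r, x ^+ i * y ^+ (n - i) = d * r.
  move=> le_in.
  have := @frac_exp_pair_mem (@tofrac R @` I) (tofrac x) (tofrac y) n i.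
  rewrite E => -[||//|_ [r ->] /eqP]; [by exists x|by exists y|].
  by rewrite -!tofracXn -tofracM tofrac_eq => /eqP e; exists r.
have [i [le_in [r [e nQr]]]] :
    exists i, (i <= n)%N /\ exists r, x ^+ i * y ^+ (n - i) = d * r /\ ~ Q r.
  apply: contrapT => no.
  have : frac_exp (@tofrac R @` I) n `<=`
      @tofrac R @` [set z | exists2 q, Q q & z = d * q].
    apply: (@frac_exp_pair_sub _ _ (tofrac x) (tofrac y)).
    - have [Q0 QD QM] := idQ; split.
      + by exists 0; [exists 0; rewrite ?mulr0|rewrite tofrac0].
      + move=> _ _ [_ [p Qp ->] <-] [_ [q Qq ->] <-]; exists (d * (p + q)).
          by exists (p + q) => //; exact: QD.
        by rewrite mulrDr; exact: tofracD.
      + move=> s _ [_ [p Qp ->] <-]; exists (d * (s * p)).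
          by exists (s * p) => //; exact: QM.
        by rewrite mulrCA; exact: tofracM.
    - move=> _ [_ [_ [r ->] [s ->]] <-]; exists r, s.
      by rewrite tofracD !tofracM; ring.
    - move=> i le_in; have [r e] := mon i le_in.
      exists (d * r); last by rewrite -e tofracM !tofracXn.
      exists r => //; apply: contrapT => nQr; apply: no.
      by exists i; split=> //; exists r.
  rewrite E => /(_ (tofrac d))[|_ [q Qq ->] /eqP].
    by exists d => //; exists 1; rewrite mulr1.
  rewrite tofrac_eq -{2}[d]mulr1 => /eqP/(mulfI d0) q1.
  by apply: (prime_not1 pQ); rewrite -q1.
have ru : r \is a GRing.unit.
  apply: unit_of_no_prime => P pP Pr.
  have : P (x ^+ i * y ^+ (n - i)).
    by rewrite e mulrC; have [idP _ _] := pP; exact: idealM.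
  have [_ _ pP'] := pP => /pP'[] /(prime_exp pP).
    by move=> /(Vx P pP) PQ; rewrite PQ in Pr.
  by move=> /(Vy P pP) PQ; rewrite PQ in Pr.
have de : d = x ^+ i * y ^+ (n - i) * r^-1 by rewrite e mulrK.
have [s es] := mon n (leqnn n); rewrite subnn expr0 mulr1 in es.
have [t et] := mon 0%N isT; rewrite subn0 expr0 mul1r in et.
have [in_|ne_in] := eqVneq i n; last first.
  have lt_in : (i < n)%N by rewrite ltn_neqAle ne_in.
  right; apply: (@dvd_of_dvdX _ _ (n - i)); rewrite ?subn_gt0//.
  exists (r^-1 * s); apply: (mulfI (expf_neq0 i x0)).
  by rewrite -exprD subnKC// es de; ring.
left; apply: (dvd_of_dvdX n0 x0); exists (r^-1 * t).
by rewrite et de in_ subnn expr0; ring.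
Qed.

(** The elements supported at Q form a chain for divisibility, so their
multiples form an ideal W. A finite set of generators of W consists of
multiples of a single element q supported at Q, which therefore divides all
the others; a proper factorization of q would contradict this. *)
Lemma irreducible_supported_at Q x : prime_ideal Q -> Q x -> x != 0 ->
  exists2 q, irreducible_elt q & supported_at Q q.
Proof.
move=> pQ Qx x0; have [a a0 Va] := exists_supported_at pQ Qx x0.
pose E b := b != 0 /\ supported_at Q b.
have total b c : E b -> E c -> principal b c \/ principal c b.
  by move=> [b0 [_ Vb]] [c0 [_ Vc]]; exact: (dvd_total pQ).
have trans b c z : principal b c -> principal c z -> principal b z.
  by move=> [r ->] [s ->]; exists (r * s); rewrite mulrA.
have common b c : E b -> E c -> exists2 e, E e & principal e b /\ principal e c.
  have refl e : principal e e by exists 1; rewrite mulr1.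
  by move=> Eb Ec; have [] := total b c Eb Ec; [exists b|exists c].
pose W := [set z | exists2 b, E b & principal b z].
have idW : ideal W.
  split; first by exists a => //; exists 0; rewrite mulr0.
    move=> y z [b Eb bz] [c Ec cz]; have [e Ee [eb ec]] := common b c Eb Ec.
    exists e => //; have [_ + _] := ideal_principal e; apply.
      exact: trans bz.
    exact: trans cz.
  move=> s z [b Eb bz]; exists b => //.
  by have [_ _] := ideal_principal b; exact.
have [_ noethR _] := dedR; have [s Ws] := noethR W idW.
have sW z : z \in s -> W z by move=> zs; rewrite Ws => M [_]; exact.
have [q Eq qs] : exists2 q, E q & forall z, z \in s -> principal q z.
  elim: s sW {Ws} => [_|z s IHs zsW]; first by exists a.
  have [z' z's|b Eb bs] := IHs; first by apply: zsW; rewrite inE z's orbT.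
  have [|c Ec cz] := zsW z; first by rewrite inE eqxx.
  have [e Ee [eb ec]] := common b c Eb Ec; exists e => // z'.
  by rewrite inE => /orP[/eqP->|/bs]; [exact: trans cz|exact: trans].
have qE b : E b -> principal q b.
  move=> Eb; have : W b by exists b => //; exists 1; rewrite mulr1.
  by rewrite Ws; apply; split; [exact: ideal_principal|move=> z; exact: qs].
have [q0 [Qq Vq]] := Eq; exists q => //; split=> //.
  exact: prime_not_unit Qq.
move=> b c e; have [bu|nbu] := boolP (b \is a GRing.unit); [by left|right].
have b0 : b != 0 by apply: contraNneq q0 => b0; rewrite e b0 mul0r.
have Vb P : prime_ideal P -> P b -> P = Q.
  move=> pP Pb; apply: Vq => //; rewrite e; have [idP _ _] := pP.
  exact: idealM.
have [|t bt] := qE b.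
  split=> //; split=> //; apply: contrapT => nQb; move/negP: nbu; apply.
  by apply: unit_of_no_prime => P pP Pb; apply: nQb; rewrite -(Vb P).
apply/unitrPr; exists t; apply: (mulfI q0).
by rewrite mulr1 {2}e bt; rewrite mulrA mulrAC -bt -e.
Qed.

(** An element outside Q is invertible modulo q, because Q is the only prime
over q; an element y of Q has a power divisible by q, because the factor
1 - y * s given by [pi_regular] is outside Q. *)
Lemma supported_at_almost_prime Q q : prime_ideal Q -> irreducible_elt q ->
  supported_at Q q -> almost_prime q.
Proof.
move=> pQ irrq [Qq Vq]; split=> //; rewrite ideal_span1; split.
- exact: ideal_principal.
- apply/eqP => qT; have [_ /negP qu _] := irrq; apply: qu.
  have : principal q 1 by rewrite qT.
  by move=> [r e]; apply/unitrPr; exists r.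
have [q0 _ _] := irrq.
have comb z s : coprime_elts q s -> principal q (s * z) -> principal q z.
  move=> [u [v e]] [k ek]; exists (u * z + k * v).
  rewrite -[LHS]mul1r -e.
  have -> : (q * u + s * v) * z = q * u * z + s * z * v by ring.
  by rewrite ek; ring.
move=> x y qxy; have [Qy|nQy] := pselect (Q y); last first.
  left; apply: (comb x y); last by rewrite mulrC.
  by apply: coprime_eltsP => P pP Pq; rewrite (Vq P).
right; have [m [s [k e]]] := pi_regular dedR y q0.
exists m.+1 => //; rewrite exprS mulrC.
apply: idealM; first exact: ideal_principal.
apply: (comb _ (1 - y * s)); last by exists k; rewrite mulrC.
by apply: coprime_eltsP => P pP Pq; rewrite (Vq P) //; exact: prime_one_sub.
Qed.

(** Let Q be a prime over q and p in Q. Some p ^+ m * (1 - p * s) is a multiple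
of q, and 1 - p * s is not, so primariness of (q) makes a power of p a multiple
of q. Hence every prime over q contains Q. *)
Lemma almost_prime_supported_at q : almost_prime q ->
  exists2 Q, prime_ideal Q & supported_at Q q.
Proof.
rewrite /almost_prime ideal_span1 => -[[q0 /negP qu _] [_ _ primq]].
have [|Q pQ subQ] := prime_over_proper (ideal_principal q).
  by move=> [r e]; apply: qu; apply/unitrPr; exists r.
have Pq P : prime_ideal P -> principal q `<=` P <-> P q.
  move=> [idP _ _]; split; first by apply; exists 1; rewrite mulr1.
  by move=> Pq _ [r ->]; exact: idealM.
have Qq : Q q by exact/Pq.
exists Q => //; split=> // P pP Pq'; apply/esym.
apply: (prime_max dedR pQ pP q0 Qq) => p Qp.
have [m [s [k e]]] := pi_regular dedR p q0.
have [||[n _ qn]] := primq (1 - p * s) (p ^+ m).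
- by exists k; rewrite -e mulrC.
- by move=> /subQ /(prime_one_sub pQ Qp).
- apply: (prime_exp (n := m * n) pP); rewrite exprM.
  exact: (proj2 (Pq P pP) Pq').
Qed.

(** Divisibility being total among the elements supported at [Q], an
irreducible one divides all the others; since the powers of [q] dividing [y]
are bounded, [y] is a unit times one of them. *)
Lemma supported_at_pow Q q y :
    prime_ideal Q -> irreducible_elt q -> supported_at Q q ->
    y != 0 -> (forall P, prime_ideal P -> P y -> P = Q) ->
  exists u t, u \is a GRing.unit /\ y = u * q ^+ t.
Proof.
move=> pQ [q0 qu irrq] [Qq Vq] y0 Vy.
have [N nN] := expr_not_dvd dedR q0 qu y0.
elim: N y y0 Vy nN => [|N IHN] y y0 Vy nN.
  by case: nN; exists y; rewrite expr0 mul1r.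
have [yu|nyu] := boolP (y \is a GRing.unit).
  by exists y, 0%N; rewrite expr0 mulr1.
have [z ez] : principal q y.
  have [//|[r e]] := dvd_total pQ q0 y0 Vq Vy.
  have [|ru] := irrq _ _ e; first by rewrite (negbTE nyu).
  by exists r^-1; rewrite e mulrK.
have [||| u [t [uu e]]] := IHN z.
- by apply: contraNneq y0 => z0; rewrite ez z0 mulr0.
- move=> P pP Pz; apply: Vy => //; rewrite ez mulrC.
  by have [idP _ _] := pP; exact: idealM.
- by move=> [r e]; apply: nN; exists r; rewrite ez e exprS mulrA.
by exists u, t.+1; rewrite ez e exprS mulrCA.
Qed.

End Torsion.

(** * Neighbourhoods and closures in the Golomb space *)

Lemma finI_from_ind (T : choiceType) (A C : set (set T)) :
    C setT -> (forall U V, C U -> C V -> C (U `&` V)) -> A `<=` C ->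
  finI_from A id `<=` C.
Proof.
move=> CT CI AC _ [D DA <-]; rewrite bigcap_fset big_seq.
by elim/big_ind: _ => // U UD; apply: AC; move/DA: UD; rewrite inE.
Qed.

Section GolombTopology.
Variable R : idomainType.
Implicit Types (x y z t w : golomb R) (U A B : set (golomb R)) (d f : R).

Definition to_golomb (a : R) (a0 : a != 0) : golomb R := exist _ a a0.

Lemma val_to_golomb (a : R) (a0 : a != 0) : val (to_golomb a0) = a.
Proof. by []. Qed.

Definition golomb_ball (x : golomb R) (d : R) : set (golomb R) :=
  golomb_coset (val x) (principal d).

Lemma golomb_ballxx x d : golomb_ball x d x.
Proof. by exists 0; [exists 0; rewrite mulr0|rewrite addr0]. Qed.

(** Makes explicit the unions of finite intersections that the construction of
the topology from its subbase hides; [ptop_openE] does so for the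
P-topology. *)
Lemma golomb_openE U :
  open U = (exists2 D, D `<=` finI_from (@golomb_cosets R) id &
                       \bigcup_(A in D) A = U).
Proof. by []. Qed.

Lemma open_golomb_ball x d : d != 0 -> coprime_elts (val x) d ->
  open (golomb_ball x d).
Proof.
move=> d0 [r [s e]]; rewrite golomb_openE.
exists [set golomb_ball x d]; last by rewrite bigcup_set1.
move=> _ ->; apply: finI_from1; exists (val x), (principal d).
split=> //; first exact: ideal_principal.
  by exists d => //; exists 1; rewrite mulr1.
apply/span_eqT; first exact: ideal_principal.
by exists (d * s); [exists s|exists r; rewrite addrC].
Qed.

(** Cosets of principal ideals suffice: an ideal comaximal with x contains an
element comaximal with x. *)
Lemma nbhs_golombP x U : nbhs x U <->
  exists d, [/\ d != 0, coprime_elts (val x) d & golomb_ball x d `<=` U].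
Proof.
split=> [|[d [d0 xd dU]]]; last first.
  apply: (@filterS _ (nbhs x) _ (golomb_ball x d)) => //.
  apply: open_nbhs_nbhs.
  by split; [exact: open_golomb_ball|exact: golomb_ballxx].
rewrite nbhsE => -[V [oV Vx] VU]; move: oV; rewrite golomb_openE => -[D DF DV].
move: Vx; rewrite -DV => -[A DA Ax].
suff [d [d0 xd dA]] : exists d,
    [/\ d != 0, coprime_elts (val x) d & golomb_ball x d `<=` A].
  by exists d; split=> // y /dA Ay; apply: VU; rewrite -DV; exists A.
move: Ax; move: A {DA} (DF _ DA); apply: finI_from_ind.
- move=> _; exists 1; split=> //; first exact: oner_neq0.
  by exists 0, 1; ring.
- move=> A B IA IB [/IA[d [d0 xd dA]] /IB[e [e0 xe eB]]].
  exists (d * e); split; first by rewrite mulf_neq0.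
    exact: coprime_eltsMr.
  move=> y [_ [r ->] yE]; split; [apply: dA|apply: eB].
    by exists (d * (e * r)); [exists (e * r)|rewrite mulrA].
  by exists (e * (d * r)); [exists (d * r)|rewrite mulrCA mulrA].
- move=> _ [a [I [idI [i Ii i0] /(span_eqT _ idI)[k Ik [r e]] ->]]] [j Ij xE].
  have key d : I d -> coprime_elts (val x) d -> d != 0 ->
      exists d, [/\ d != 0, coprime_elts (val x) d &
        golomb_ball x d `<=` golomb_coset a I].
    move=> Id xd d0; exists d; split=> // y [_ [s ->] yE].
    exists (j + d * s); last by rewrite yE xE addrA.
    by have [_ ID _] := idI; apply: ID => //; exact: idealM.
  (* The element k - j * r of I is comaximal with x, but it may vanish; then x
     is a unit and any nonzero element of I serves instead. *)
  have Ik' : I (k - j * r) by apply: idealB => //; exact: idealM.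
  have e' : k - j * r + val x * r = 1 by rewrite xE -e; ring.
  have [k0|k0] := eqVneq (k - j * r) 0.
    apply: (key i) => //; exists r, 0.
    by rewrite mulr0 addr0 -e' k0 add0r.
  by apply: (key _ Ik') => //; exists r, 1; rewrite mulr1 addrC.
Qed.

Lemma closure_golomb_ballP x t d : d != 0 ->
  closure (golomb_ball x d) t <->
  forall f, f != 0 -> coprime_elts (val t) f ->
    exists r s, val x - val t = d * r + f * s.
Proof.
move=> d0; split=> [clt f f0 tf|H B /nbhs_golombP[f [f0 tf fB]]].
  have [|y [[_ [r ->] e1] [_ [s ->] e2]]] := clt (golomb_ball t f).
    apply: open_nbhs_nbhs.
    by split; [exact: open_golomb_ball|exact: golomb_ballxx].
  exists (- r), s.
  have -> : val x = val t + f * s - d * r by rewrite -e2 e1 addrK.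
  by ring.
have [r [s e]] := H f f0 tf.
(* The natural common point x - d * r of the two cosets may be zero, which is
   not a point of the space; adding d * f then gives another one. *)
have [k k0] : exists k, val x - d * r + d * f * k != 0.
  have [v0|v0] := eqVneq (val x - d * r) 0.
    by exists 1; rewrite v0 add0r mulr1 mulf_neq0.
  by exists 0; rewrite mulr0 addr0.
exists (to_golomb k0); split.
  exists (d * (f * k - r)); first by exists (f * k - r).
  by rewrite val_to_golomb; ring.
apply: fB; exists (f * (s + d * k)); first by exists (s + d * k).
rewrite val_to_golomb.
have -> : val x = val t + (d * r + f * s) by rewrite -e; ring.
by ring.
Qed.

End GolombTopology.

(** * Reading supports off the topology *)

(** For distinct points z, x, w of a Golomb space this means that V(x) and V(w)
are contained in V(z); it is phrased for an arbitrary space to make its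
invariance under homeomorphisms evident. *)
Definition closures_refine (X : topologicalType) (z x w : X) : Prop :=
  forall U, nbhs z U -> exists A B, [/\ nbhs x A, nbhs w B &
    closure A `&` closure B `<=` closure U].

(** The containment V(y) <= V(x) in the Golomb space, by [refines_leP]. The
inequalities keep to triples for which [closures_refine] is meaningful. *)
Definition refines_le (X : topologicalType) (x y : X) : Prop :=
  forall z w, z <> x -> z <> y -> w <> x -> w <> y -> w <> z ->
    closures_refine z x w -> closures_refine z y w.

Section Homeomorphism.
Variables (X Y : topologicalType) (h : X -> Y) (g : Y -> X).
Hypotheses (hK : cancel h g) (gK : cancel g h).
Hypotheses (ch : continuous h) (cg : continuous g).

Lemma closure_continuous (T U : topologicalType) (f : T -> U) (A : set U) :
  continuous f -> closure (f @^-1` A) `<=` f @^-1` closure A.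
Proof. by move=> cf x clx B /cf /clx[y [Ay By]]; exists (f y). Qed.

Lemma closures_refine_homeo z x w :
  closures_refine z x w -> closures_refine (h z) (h x) (h w).
Proof.
move=> zxw U zU; have [A [B [xA wB AB]]] := zxw _ (ch zU).
exists (g @^-1` A), (g @^-1` B); split.
- by apply: cg; rewrite hK.
- by apply: cg; rewrite hK.
- move=> t [/(closure_continuous cg) tA /(closure_continuous cg) tB].
  by rewrite -[t]gK; apply: (closure_continuous ch); apply: AB.
Qed.

End Homeomorphism.

Lemma refines_le_homeo (X Y : topologicalType) (h : X -> Y) (g : Y -> X) x y :
    cancel h g -> cancel g h -> continuous h -> continuous g ->
  refines_le x y -> refines_le (h x) (h y).
Proof.
move=> hK gK ch cg xy z w zx zy wx wy wz zxw.
rewrite -[z]gK -[w]gK; apply: (closures_refine_homeo hK gK ch cg).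
apply: xy => [e|e|e|e|e|]; [apply: zx|apply: zy|apply: wx|apply: wy|apply: wz|].
1-4: by rewrite -e gK.
  by rewrite -[w]gK e gK.
by rewrite -(hK x); exact: (closures_refine_homeo gK hK cg ch).
Qed.

Section Support.
Variable R : idomainType.
Hypotheses (dedR : dedekind_domain R) (torR : torsion_class_group R).
Implicit Types (x y z t w : golomb R) (P Q : set R).

(** Let d be the modulus of a coset around z contained in U. Some d ^+ m,
multiplied by an element outside all primes over d, is a multiple of x - w, so
modulo d ^+ m.+1 the elements x and w differ at each prime over d. A point t in
both closures is therefore contained in all primes over d, that is, every f
comaximal with t is comaximal with d; then t is in the closure of z + (d). *)
Lemma supp_le_closures_refine z x w : x <> w ->
  supp_le (val x) (val z) -> supp_le (val w) (val z) -> closures_refine z x w.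
Proof.
move=> xw xz wz U /nbhs_golombP[d [d0 zd dU]].
have e0 : val x - val w != 0.
  by rewrite subr_eq0; apply/eqP => /val_inj.
have [m [s [g eg]]] := pi_regular dedR d e0.
have j0 : d ^+ m.+1 != 0 by exact: expf_neq0.
have nb (v : golomb R) :
    supp_le (val v) (val z) -> nbhs v (golomb_ball v (d ^+ m.+1)).
  move=> vz; apply/nbhs_golombP; exists (d ^+ m.+1); split=> //.
  apply: coprime_eltsX; apply: coprime_eltsP => P pP /(vz P pP).
  exact: coprime_prime.
exists (golomb_ball x (d ^+ m.+1)), (golomb_ball w (d ^+ m.+1)).
split; [exact: nb|exact: nb|move=> t [tx tw]].
apply: (closureS dU); apply/(closure_golomb_ballP _ _ d0) => f f0 tf.
suff [r [k e]] : coprime_elts d f.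
  exists (r * (val z - val t)), (k * (val z - val t)).
  by rewrite !mulrA -mulrDl e mul1r.
apply: coprime_eltsP => P pP Pd Pf.
have [n [s' [k ek]]] := pi_regular dedR f j0.
have fn0 : f ^+ n != 0 by exact: expf_neq0.
have tfn := coprime_eltsX n tf.
have [r1 [s1 e1]] := (closure_golomb_ballP _ _ j0).1 tx _ fn0 tfn.
have [r2 [s2 e2]] := (closure_golomb_ballP _ _ j0).1 tw _ fn0 tfn.
pose r := (1 - f * s') * (r1 - r2) + k * (s1 - s2).
have ce : (1 - f * s') * (val x - val w) = d ^+ m.+1 * r.
  have -> : val x - val w = (val x - val t) - (val w - val t) by ring.
  rewrite e1 e2 /r [RHS]mulrDr [_ * (k * _)]mulrA -ek; ring.
have : d ^+ m * (d * r * g) = d ^+ m * ((1 - f * s') * (1 - d * s)).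
  have -> : d ^+ m * (d * r * g) = d ^+ m.+1 * r * g by rewrite exprS; ring.
  by rewrite -ce -mulrA -eg; ring.
move=> /(mulfI (expf_neq0 _ d0)) E.
apply: (@prime_mulN _ P (1 - f * s') (1 - d * s)) => //.
- exact: prime_one_sub.
- exact: prime_one_sub.
- by rewrite -E -mulrA; have [idP _ _] := pP; exact: idealM.
Qed.

Lemma closures_refineC z x w : closures_refine z x w -> closures_refine z w x.
Proof.
move=> zxw U /zxw[A [B [xA wB AB]]]; exists B, A; split=> // t [tB tA].
exact: AB.
Qed.

(** Suppose that x lies in P but z does not. Closeness to x puts no condition
modulo powers of P on the points of cl A, and closeness to w at most the
condition of being near w modulo such a power. So cl A /\ cl B contains a
point t outside P that is near y0 modulo a power of P, where y0 is w or, if w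
lies in P, a suitable element outside P. When U is the coset of z modulo a
power a ^+ N that does not divide y0 - z, this t is not in cl U. *)
Lemma closures_refine_supp_le z x w : z <> w -> closures_refine z x w ->
  supp_le (val x) (val z).
Proof.
move=> zw zxw P pP Px; apply: contrapT => nPz.
have [idP _ primP] := pP.
have [a a0 [Pa Va]] := exists_supported_at dedR torR pP Px (valP x).
have au : a \isn't a GRing.unit by exact: prime_not_unit pP Pa.
have cop b : ~ P b -> coprime_elts b a.
  move=> nPb; apply: coprime_eltsP => Q pQ Qb /(Va Q pQ) QP.
  by rewrite QP in Qb.
(* If w lies in P, the target z * (1 + a) differs from z modulo the square of
   a, since a does not divide z. *)
have [y0 [N [nPy0 dvdN yw]]] : exists (y0 : R) (N : nat), [/\ ~ P y0,
    ~ principal (a ^+ N) (y0 - val z) & ~ P (val w) -> y0 = val w].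
  have [Pw|nPw] := pselect (P (val w)); last first.
    have [|N nN] := expr_not_dvd (e := val w - val z) dedR a0 au.
      by rewrite subr_eq0; apply/eqP => /val_inj wz; exact: zw.
    by exists (val w), N; split.
  exists (val z * (1 + a)), 2%N; split=> // [Py|[r e]].
    have [//|] := primP _ _ Py.
    by apply: prime_addN => //; exact: prime_not1.
  apply: nPz; have -> : val z = a * r; last exact: idealM.
  apply: (mulfI a0); have -> : a * val z = val z * (1 + a) - val z by ring.
  by rewrite e expr2 mulrA.
have [|A [B [xA wB AB]]] := zxw (golomb_ball z (a ^+ N)).
  apply: open_nbhs_nbhs; split; last exact: golomb_ballxx.
  by apply: open_golomb_ball; [exact: expf_neq0|exact/coprime_eltsX/cop].
have [d1 [d1_0 xd1 d1A]] := (nbhs_golombP _ _).1 xA.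
have [d2 [d2_0 wd2 d2B]] := (nbhs_golombP _ _).1 wB.
have nPd1 : ~ P d1 by exact: coprime_prime Px.
(* The multiples of i0 that are near y0 modulo a ^+ M belong to cl B: when w is
   outside P, i0 = 1 - a * s takes care of the primes over d2 other than P. *)
have [i0 [M [nPi0 wt]]] : exists (i0 : R) (M : nat), ~ P i0 /\ forall t k l,
    val t = i0 * k -> val t = y0 + a ^+ M * l -> closure (golomb_ball w d2) t.
  have [Pw|nPw] := pselect (P (val w)).
    exists d2, 0%N; split; first exact: coprime_prime Pw.
    move=> t k l tk _; apply/(closure_golomb_ballP _ _ d2_0) => f f0 [r [s e]].
    exists (k * r * (val w - val t)), (s * (val w - val t)).
    by rewrite -[LHS]mul1r -e tk; ring.
  have [m [s [k ek]]] := pi_regular dedR a d2_0.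
  exists (1 - a * s), m; split; first exact: prime_one_sub.
  move=> t k' l tk tl; apply/(closure_golomb_ballP _ _ d2_0) => f f0 [r [s' e]].
  exists (- (k * k' * r * l)), (- (a ^+ m * s' * l)).
  have -> : val w - val t = - (a ^+ m * l * 1) by rewrite tl yw //; ring.
  rewrite -e tk.
  have -> : d2 * - (k * k' * r * l) = - (d2 * k * (k' * r * l)) by ring.
  by rewrite -ek; ring.
have nPid : ~ P (i0 * d1) by exact: prime_mulN.
(* Chinese remainders: t0 is a multiple of i0 and d1, near y0 modulo a power
   of a. The exponent is made positive so that t0 stays outside P. *)
have [v [l e]] := coprime_eltsX (M + N).+1 (cop _ nPid).
pose t0 := i0 * d1 * v * y0.
have t0E : t0 = y0 - a ^+ (M + N).+1 * (l * y0).
  rewrite /t0.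
  have -> : i0 * d1 * v = 1 - a ^+ (M + N).+1 * l by rewrite -e; ring.
  by ring.
have nPt0 : ~ P t0.
  have -> : t0 = y0 + a * (- a ^+ (M + N) * (l * y0)).
    by rewrite t0E exprS; ring.
  by apply: prime_addN => //; exact: idealM.
have t0_0 : t0 != 0 by apply/eqP => t00; apply: nPt0; rewrite t00; case: idP.
pose t := to_golomb t0_0; have tE : val t = t0 by [].
have tA : closure A t.
  apply: (closureS d1A).
  apply/(closure_golomb_ballP _ _ d1_0) => f f0 [r [s e1]].
  exists (i0 * v * y0 * r * (val x - val t)), (s * (val x - val t)).
  by rewrite -[LHS]mul1r -e1 tE /t0; ring.
have tB : closure B t.
  apply: (closureS d2B); apply: (wt t (d1 * v * y0) (- a ^+ N.+1 * (l * y0))).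
    by rewrite tE /t0; ring.
  by rewrite tE t0E -addnS exprD; ring.
have aN0 : a ^+ N != 0 by exact: expf_neq0.
have taN : coprime_elts (val t) (a ^+ N) by apply: coprime_eltsX; exact: cop.
have [r [s e1]] :=
  (closure_golomb_ballP _ _ aN0).1 (AB _ (conj tA tB)) _ aN0 taN.
apply: dvdN; exists (a ^+ M.+1 * (l * y0) - (r + s)).
have -> : y0 - val z = a ^+ (M + N).+1 * (l * y0) - (val z - val t).
  by rewrite tE t0E; ring.
by rewrite e1 addnC -addnS exprD; ring.
Qed.

(** If V(y) is contained in V(x), then also in every V(z) that contains V(x).
Conversely, if some prime P contains y but not x, then multiples of x outside
P refute [refines_le]: take w = x * (1 + y) and z = w * (1 + y ^+ 2), for
which V(x) and V(w) are contained in V(z) while P contains y and not z. These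
witnesses are distinct from each other and from x and y even when R has few
units. *)
Lemma refines_leP x y : refines_le x y <-> supp_le (val y) (val x).
Proof.
split=> [xy P pP Py|yx z w zx zy wx wy wz zxw]; last first.
  have xz : supp_le (val x) (val z).
    by apply: closures_refine_supp_le zxw => /esym.
  have wz' : supp_le (val w) (val z).
    by apply: closures_refine_supp_le (closures_refineC zxw) => /zx.
  apply: supp_le_closures_refine => //; first by move=> /esym.
  by move=> P pP /(yx P pP); exact: xz.
apply: contrapT => nPx; have [idP _ primP] := pP.
set b := val y in Py; set a := val x in nPx.
have nP1 := prime_not1 pP.
have nP1b : ~ P (1 + b) by exact: prime_addN.
have Pb2 : P (b ^+ 2) by rewrite expr2; exact: idealM.
have nP1b2 : ~ P (1 + b ^+ 2) by exact: prime_addN.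
have nz c : ~ P c -> c != 0 by apply: contra_notN => /eqP->; case: idP.
have nPw : ~ P (a * (1 + b)) by exact: prime_mulN.
have nPz : ~ P (a * (1 + b) * (1 + b ^+ 2)) by exact: prime_mulN.
pose w := to_golomb (nz _ nPw); pose z := to_golomb (nz _ nPz).
have a0 : a != 0 by exact: valP x.
have b0 : b != 0 by exact: valP y.
have mul1 c : a * c = a -> c = 1.
  by rewrite -{2}[a]mulr1 => /(mulfI a0).
have zx : z <> x.
  move=> /(congr1 val); rewrite val_to_golomb -/a -mulrA => /mul1 e1.
  apply: nP1; have -> : 1 = - b * (1 + b).
    apply: (mulfI b0).
    have -> : b * (- b * (1 + b)) = b - ((1 + b) * (1 + b ^+ 2) - 1) by ring.
    by rewrite e1; ring.
  by apply: idealM => //; rewrite -sub0r; apply: idealB => //; case: idP.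
have wx : w <> x.
  move=> /(congr1 val); rewrite val_to_golomb -/a => /mul1 e1.
  by move/negP: b0; apply; apply/eqP; rewrite -[b](addKr 1) e1 addNr.
have wz : w <> z.
  move=> /(congr1 val); rewrite !val_to_golomb => e1.
  move/negP: (expf_neq0 2 b0); apply.
  have /(mulfI (nz _ nPw)) e2 :
    a * (1 + b) * (1 + b ^+ 2) = a * (1 + b) * 1 by rewrite mulr1.
  by apply/eqP; rewrite -[b ^+ 2](addKr 1) e2 addNr.
have zy : z <> y by move=> e1; apply: (nPz); rewrite /b -e1 in Py.
have wy : w <> y by move=> e1; apply: (nPw); rewrite /b -e1 in Py.
have mulsupp c d : supp_le c (c * d).
  by move=> Q [idQ _ _] Qc; exact: idealM.
apply: (nPz); rewrite -(val_to_golomb (nz _ nPz)).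
apply: (@closures_refine_supp_le z y w) => //; first by move=> /esym.
apply: xy => //; apply: supp_le_closures_refine; first by move=> /esym.
  by rewrite val_to_golomb -mulrA; exact: mulsupp.
by rewrite !val_to_golomb; exact: mulsupp.
Qed.

End Support.

(** * Primes and their powers under homeomorphisms *)

Section MinimalSupports.
Variable R : idomainType.
Hypotheses (dedR : dedekind_domain R) (torR : torsion_class_group R).
Implicit Types (x y z : golomb R) (P Q : set R) (a b : R).

Lemma supported_at_supp_le P a b : prime_ideal P -> supported_at P a ->
  supp_le a b <-> P b.
Proof.
move=> pP [Pa Va]; split=> [|Pb Q pQ Qa]; first exact.
by rewrite (Va Q pQ Qa).
Qed.

Lemma supported_at_supp_eq P a b : prime_ideal P -> supported_at P a ->
  supported_at P b <-> supp_le a b /\ supp_le b a.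
Proof.
move=> pP Va; rewrite (supported_at_supp_le b pP Va).
split=> [Vb|[Pb ba]]; last by split=> // Q pQ /(ba Q pQ); exact: Va.2.
by rewrite (supported_at_supp_le a pP Vb); split; [case: Vb|case: Va].
Qed.

(** Supports that are a single prime are the minimal nonempty ones. Emptiness of
V(x) is expressed by V(x) being contained in every V(y), which keeps the
criterion in terms of [supp_le] alone, and thus invariant. *)
Lemma supported_atP x :
  (exists2 P, prime_ideal P & supported_at P (val x)) <->
  ~ (forall y, supp_le (val x) (val y)) /\
  (forall y, supp_le (val y) (val x) ->
     supp_le (val x) (val y) \/ forall z, supp_le (val y) (val z)).
Proof.
split=> [[P pP [Px Vx]]|[ntriv minx]].
  split=> [/(_ (to_golomb (oner_neq0 R)) P pP Px)|y yx].
    exact: prime_not1.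
  have [Py|nPy] := pselect (P (val y)).
    by left=> Q pQ Qx; rewrite (Vx Q pQ Qx).
  right=> z Q pQ Qy; have QP := Vx Q pQ (yx Q pQ Qy).
  by rewrite QP in Qy.
have [P pP Px] : exists2 P, prime_ideal P & P (val x).
  apply: contrapT => noP; apply: ntriv => y Q pQ Qx; exfalso.
  by apply: noP; exists Q.
have [a a0 Va] := exists_supported_at dedR torR pP Px (valP x).
have [|xa|triv] := minx (to_golomb a0).
- by move=> Q pQ Qa; case: Va => _ /(_ Q pQ Qa) ->.
- exists P => //; apply/(supported_at_supp_eq _ pP Va); split=> //.
  by move=> Q pQ Qa; case: Va => _ /(_ Q pQ Qa) ->.
- case: (prime_not1 pP).
  by apply: (triv (to_golomb (oner_neq0 R)) P pP); case: Va.
Qed.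

End MinimalSupports.

Lemma ptop_openE (R : idomainType) (P : set R) (U : set (@ptop R P)) :
  open U = (exists2 D,
    D `<=` finI_from [set V : set (golomb_off P) | clopen V] id &
    \bigcup_(A in D) A = U).
Proof. by []. Qed.

Section OffPrime.
Variables (R S : idomainType) (P : set R) (P' : set S).
Variable h : golomb R -> golomb S.
Hypothesis hP : forall x, golomb_off P x -> golomb_off P' (h x).

Definition off_map (x : golomb_off P) : golomb_off P' :=
  exist _ (h (val x)) (mem_set (hP (set_mem (valP x)))).

Lemma off_map_continuous : continuous h -> continuous off_map.
Proof.
move=> ch; apply/continuousP => _ [V oV <-].
have -> : off_map @^-1` (set_val @^-1` V) = set_val @^-1` (h @^-1` V) by [].
exists (h @^-1` V) => //.
by move/continuousP: ch; apply.
Qed.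

(** The P-topology has the clopen sets of R \ P as a subbase, and preimages of
clopen sets under a continuous map are clopen. *)
Lemma ptop_map_continuous : continuous h ->
  continuous (off_map : ptop P -> ptop P').
Proof.
move=> /off_map_continuous ch; apply/continuousP => U.
rewrite ptop_openE => -[D DF <-]; rewrite preimage_bigcup.
apply: bigcup_open => A DA; move: A {DA} (DF _ DA).
apply: finI_from_ind.
- by rewrite preimage_setT; exact: openT.
- by move=> A B oA oB; rewrite preimage_setI; exact: openI.
- move=> A clA; rewrite /= ptop_openE; exists [set (off_map @^-1` A)].
    by move=> _ ->; apply: finI_from1; exact: preimage_clopen.
  exact: bigcup_set1.
Qed.

End OffPrime.

Section PrimePowers.
Variable R : idomainType.
Hypotheses (dedR : dedekind_domain R) (torR : torsion_class_group R).

(** An element u * q ^+ t with t > 0 has the same support as q; conversely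
[supported_at_pow] applies, with t > 0 because x lies in Q. *)
Lemma pow_setE (P Q : set R) q :
    prime_ideal Q -> almost_prime q -> supported_at Q q ->
  @pow_set R P q = [set x | supported_at Q (val (val x))].
Proof.
move=> pQ [irrq _] Vq; have [Qq suppq] := Vq.
apply/seteqP; split=> x.
  move=> [u [t [uu t0 e]]]; split; rewrite e.
    have [idQ _ _] := pQ; rewrite -(prednK t0) exprS mulrCA; exact: idealM.
  move=> Q' pQ' /=; have [_ _ /[apply]] := pQ'.
  by case=> [/(prime_not_unit pQ') /negP//|/(prime_exp pQ')]; exact: suppq.
move=> [Qx Vx].
have [|u [t [uu e]]] :=
    supported_at_pow dedR torR pQ irrq Vq (valP (val x)).
  by move=> Q' pQ' /(Vx Q' pQ').
exists u, t; split=> //; rewrite lt0n; apply/eqP => t0; subst t.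
move: Qx; rewrite e expr0 mulr1 => /(prime_not_unit pQ).
by rewrite uu.
Qed.

End PrimePowers.

Section GolombHomeomorphism.
Variables (R S : idomainType).
Hypotheses (dedR : dedekind_domain R) (dedS : dedekind_domain S).
Hypotheses (torR : torsion_class_group R) (torS : torsion_class_group S).
Variables (h : golomb R -> golomb S) (g : golomb S -> golomb R).
Hypotheses (hK : cancel h g) (gK : cancel g h).
Hypotheses (ch : continuous h) (cg : continuous g).
Implicit Types (x y : golomb R) (P Q : set R).

Lemma supp_le_homeo x y :
  supp_le (val x) (val y) <-> supp_le (val (h x)) (val (h y)).
Proof.
rewrite -(refines_leP dedR torR) -(refines_leP dedS torS).
split; first exact: refines_le_homeo.
by rewrite -{2}[x]hK -{2}[y]hK; exact: refines_le_homeo.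
Qed.

Lemma supported_at_homeo P x : prime_ideal P -> supported_at P (val x) ->
  exists2 P' : set S, prime_ideal P' & supported_at P' (val (h x)).
Proof.
move=> pP Vx; apply/(supported_atP dedS torS).
have [ntriv minx] :=
  (supported_atP dedR torR x).1 (ex_intro2 _ _ P pP Vx).
split=> [triv|y].
  by apply: ntriv => y; apply/supp_le_homeo.
rewrite -[y]gK => /supp_le_homeo/minx[xy|triv].
  by left; apply/supp_le_homeo.
by right=> z; rewrite -[z]gK; apply/supp_le_homeo.
Qed.

Lemma golomb_imageE P (P' : set S) x : prime_ideal P -> prime_ideal P' ->
    supported_at P (val x) -> supported_at P' (val (h x)) ->
  golomb_image h P = P'.
Proof.
move=> pP pP' Vx Vhx; have [[P'0 _ _] _ _] := pP'.
have PP' y : P (val y) <-> P' (val (h y)).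
  rewrite -(supported_at_supp_le _ pP Vx) -(supported_at_supp_le _ pP' Vhx).
  exact: supp_le_homeo.
apply/seteqP; split=> b; first by move=> [->//|[y /PP' P'y <-]].
have [->|b0] := eqVneq b 0; [by left|right].
exists (g (to_golomb b0)); last by rewrite gK.
by apply/PP'; rewrite gK.
Qed.

Lemma golomb_image_prime P : prime_ideal P -> P != [set 0] ->
  exists P' : set S, [/\ prime_ideal P', P' != [set 0], golomb_image h P = P' &
    forall y, P (val y) <-> P' (val (h y))].
Proof.
move=> pP P0; have [a Pa a0] : exists2 a, P a & a != 0.
  apply: contrapT => no; move/eqP: P0; apply; apply/seteqP; split=> [a Pa|_ ->].
    by apply: contrapT => /eqP a0; apply: no; exists a.
  by have [[]] := pP.
have [b b0 Vb] := exists_supported_at dedR torR pP Pa a0.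
have [P' pP' Vhb] := supported_at_homeo (x := to_golomb b0) pP Vb.
exists P'; split=> //.
- apply/eqP => P'0; have [] := Vhb; rewrite P'0 => /eqP.
  by rewrite (negbTE (valP (h (to_golomb b0)))).
- exact: golomb_imageE Vhb.
- move=> y; rewrite -(supported_at_supp_le _ pP Vb).
  rewrite -(supported_at_supp_le _ pP' Vhb) -[b]/(val (to_golomb b0)).
  exact: supp_le_homeo.
Qed.

End GolombHomeomorphism.

(** With Q the support of q, the support of h(q) is a single prime Q', and h
maps the elements supported at Q onto those supported at Q'. The almost prime
q' is any irreducible element supported at Q'; it need not be h(q). *)
Lemma image_pow_closures (R S : idomainType)
    (dedR : dedekind_domain R) (dedS : dedekind_domain S)
    (torR : torsion_class_group R) (torS : torsion_class_group S)
    (h : golomb R -> golomb S) (g : golomb S -> golomb R)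
    (hK : cancel h g) (gK : cancel g h) (ch : continuous h) (cg : continuous g)
    (P : set R) X :
  prime_ideal P -> P != [set 0] ->
  pow_closures P X -> pow_closures (golomb_image h P) (h @` X).
Proof.
move=> pP P0 [q [apq nPq ->]].
have [P' [pP' P'0 -> PP']] :=
  golomb_image_prime dedR dedS torR torS hK gK ch cg pP P0.
have [Q pQ Vq] := almost_prime_supported_at dedR apq.
have q0 : q != 0 by have [[]] := apq.
pose x := to_golomb q0.
have [Q' pQ' Vhx] :=
  supported_at_homeo dedR dedS torR torS hK gK ch cg (x := x) pQ Vq.
have [q' irrq' Vq'] :=
  irreducible_supported_at dedS torS pQ' Vhx.1 (valP (h x)).
have apq' := supported_at_almost_prime dedS pQ' irrq' Vq'.
have nP'q' : ~ P' q'.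
  move=> /(Vq'.2 P' pP') P'Q'; apply: nPq.
  by apply: (PP' x).2; rewrite P'Q'; case: Vhx.
exists q'; split=> //.
rewrite (pow_setE dedR torR P pQ apq Vq).
rewrite (pow_setE dedS torS P' pQ' apq' Vq').
have hP y : golomb_off P y -> golomb_off P' (h y) by move=> nPy /PP'.
have gP y : golomb_off P' y -> golomb_off P (g y).
  by move=> nPy /PP'; rewrite gK.
have QQ' (y : golomb R) :
    supported_at Q (val y) <-> supported_at Q' (val (h y)).
  rewrite (supported_at_supp_eq _ pQ Vq) (supported_at_supp_eq _ pQ' Vhx).
  rewrite -[q]/(val x).
  by rewrite -!(supp_le_homeo dedR dedS torR torS hK gK ch cg).
pose hm : ptop P -> ptop P' := off_map hP.
pose gm : ptop P' -> ptop P := off_map gP.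
have chm : continuous hm by exact: ptop_map_continuous.
have cgm : continuous gm by exact: ptop_map_continuous.
apply/seteqP; split.
  move=> _ [_ [u clu <-] <-]; exists (hm u) => //.
  by apply: (closure_continuous chm); apply: closureS clu => v /= /QQ'.
move=> _ [u clu <-]; exists (g (val u)); last exact: gK.
exists (gm u) => //; apply: (closure_continuous cgm).
by apply: closureS clu => v /= Vv; apply/QQ'; rewrite gK.
Qed.

Theorem proposition5p5 (R S : idomainType)
  (dedR : dedekind_domain R) (dedS : dedekind_domain S)
  (torR : torsion_class_group R) (torS : torsion_class_group S)
  (h : golomb R -> golomb S) (homeo_h : homeomorphism h)
  (P : set R) (primeP : prime_ideal P) (P_neq0 : P != [set 0]) :
  containment_isomorphism (pow_closures P) (pow_closures (golomb_image h P))
    (fun X : set (golomb R) => h @` X).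
Proof.
have [ch [g [hK gK cg]]] := homeo_h.
have [P' [pP' P'0 EP PP']] :=
  golomb_image_prime dedR dedS torR torS hK gK ch cg primeP P_neq0.
have EP' : golomb_image g P' = P.
  apply/seteqP; split=> b.
    by move=> [->|[y P'y <-]]; [case: primeP => -[]|apply/PP'; rewrite gK].
  have [->|b0] := eqVneq b 0; [by left|right].
  exists (h (to_golomb b0)); last by rewrite hK.
  by apply/PP'.
have subh (A B : set (golomb R)) : h @` A `<=` h @` B -> A `<=` B.
  move=> hAB y Ay; have [z Bz e] := hAB _ (ex_intro2 _ _ y Ay erefl).
  by rewrite -(can_inj hK e).
split; last by move=> A B _ _; split; [exact: image_subset|exact: subh].
split.
- by move=> X; exact: (image_pow_closures dedR dedS torR torS hK gK ch cg).
- by move=> A B _ _ /seteqP[/subh AB /subh BA]; apply/seteqP.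
- rewrite EP => Y XY; exists (g @` Y).
    rewrite -EP'.
    exact: (image_pow_closures dedS dedR torS torR gK hK cg ch).
  apply/seteqP; split=> y; first by move=> [_ [z Yz <-] <-]; rewrite gK.
  by move=> Yy; exists (g y) => //; exists y.
Qed.
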